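(* For every $n\ge 2$, the hypercube $Q_n$ is a square.
   Context: $Q_n$ is the graph whose vertices are the binary $n$-tuples, two being adjacent iff they differ in exactly one coordinate. All graphs are finite and simple. A partially labeled graph is a graph $H$ together with an injective map $\theta: L\to V(H)$, $L\subseteq\mathbb{N}$, whose image $\theta(L)$ is nonempty and a proper subset of $V(H)$; vertices in $\theta(L)$ are labeled. The square $HH$ is obtained from two disjoint copies of $H$ by identifying each labeled vertex $\theta(\ell)$ of the first copy with $\theta(\ell)$ of the second copy (keeping all edges, merging double edges). A graph $G$ is a square if $G\cong HH$ for some partially labeled graph $H$. *)

(* Defs.v *)
From HB Require Import structures.
From mathcomp Require Import all_boot.
From mathcomp Require Import finmap.

Set Implicit Arguments.
Unset Strict Implicit.
Unset Printing Implicit Defensive.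

Record sgraph := SGraph {
  vert :> finType;
  adj : rel vert;
  adj_sym : symmetric adj;
  adj_irr : irreflexive adj
}.

Definition graph_iso (G H : sgraph) : Prop :=
  exists2 f : G -> H, bijective f & {mono f : x y / adj x y}.

Section Hypercube.

Variable n : nat.

Definition cube_adj (x y : n.-tuple bool) : bool :=
  #|[set i : 'I_n | tnth x i != tnth y i]| == 1.

Lemma cube_adj_sym : symmetric cube_adj.
Proof.
move=> x y; rewrite /cube_adj; congr (_ == 1); apply: eq_card => i.
by rewrite !inE eq_sym.
Qed.

Lemma cube_adj_irr : irreflexive cube_adj.
Proof.
move=> x; rewrite /cube_adj (_ : [set _ | _] = set0) ?cards0 //.
by apply/setP => i; rewrite !inE eqxx.
Qed.

Definition hypercube : sgraph := SGraph cube_adj_sym cube_adj_irr.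

End Hypercube.

(* The label set is a finite set of naturals: since [lab] is injective into a
   finite vertex set, no other label set can occur. *)
Record plgraph := PLGraph {
  plg : sgraph;
  labels : {fset nat};
  lab : labels -> plg;
  lab_inj : injective lab;
  lab_nonempty : exists v : plg, v \in codom lab;
  lab_proper : exists v : plg, v \notin codom lab
}.

Section Square.

Variable H : plgraph.

Definition copies : finType := (plg H + plg H)%type.

Definition under (x : copies) : plg H :=
  match x with inl v => v | inr v => v end.

Definition copies_adj (x y : copies) : bool :=
  match x, y with
  | inl u, inl v => adj u v
  | inr u, inr v => adj u v
  | _, _ => false
  end.

Definition glue : rel copies := fun x y =>
  (x == y) ||
  [exists l : labels H, (under x == lab l) && (under y == lab l)].

Lemma glue_refl : reflexive glue.
Proof. by move=> x; rewrite /glue eqxx. Qed.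

Lemma glue_sym : symmetric glue.
Proof.
move=> x y; rewrite /glue eq_sym; congr (_ || _).
by apply: eq_existsb => l; rewrite andbC.
Qed.

Lemma glue_trans : transitive glue.
Proof.
move=> y x z /orP[/eqP-> //|/existsP[l /andP[xl yl]]].
case/orP=> [/eqP <-|/existsP[m /andP[ym zm]]]; apply/orP; right.
  by apply/existsP; exists l; rewrite xl.
by apply/existsP; exists m; rewrite (eqP xl) -(eqP yl) ym.
Qed.

Canonical glue_equiv := EquivRel glue glue_refl glue_sym glue_trans.

Definition square_quot : quotType copies := {eq_quot glue_equiv}%qT.
Definition square_vert : finType := quot_type square_quot.

Definition square_adj (a b : square_vert) : bool :=
  [exists x : copies, exists y : copies,
    [&& \pi_square_quot x == a, \pi_square_quot y == b & copies_adj x y]]%qT.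

Lemma copies_adj_sym : symmetric copies_adj.
Proof. by case=> u [] v //=; rewrite adj_sym. Qed.

Lemma glue_copies_adj x y : glue x y -> copies_adj x y = false.
Proof.
case/orP=> [/eqP<-|/existsP[l /andP[/eqP xl /eqP yl]]].
  by case: x => u /=; rewrite adj_irr.
by case: x y xl yl => u [] v //= -> ->; rewrite adj_irr.
Qed.

Lemma square_adj_sym : symmetric square_adj.
Proof.
have S a b : square_adj a b -> square_adj b a.
  case/existsP=> x /existsP[y /and3P[xa yb xy]].
  by apply/existsP; exists y; apply/existsP; exists x;
    rewrite xa yb copies_adj_sym.
by move=> a b; apply/idP/idP; apply: S.
Qed.

Lemma square_adj_irr : irreflexive square_adj.
Proof.
move=> a; apply/negbTE/negP => /existsP[x /existsP[y /and3P[/eqP xa yb]]].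
by rewrite glue_copies_adj //; apply/eqmodP; rewrite xa (eqP yb).
Qed.

Definition square : sgraph := SGraph square_adj_sym square_adj_irr.

End Square.

Definition is_square (G : sgraph) : Prop :=
  exists H : plgraph, graph_iso G (square H).

(* Main.v *)
Require Import Defs.
From mathcomp Require Import all_boot.
From mathcomp Require Import perm finmap.

Set Implicit Arguments.
Unset Strict Implicit.
Unset Printing Implicit Defensive.

(** Exchanging the first two coordinates is an involutive automorphism [phi] of
    the cube. It fixes the vertices [x] with [x_0 = x_1] and exchanges the
    vertices starting with [01] and those starting with [10]; as these two
    classes differ in two coordinates, there is no edge between them. Hence the
    cube is obtained by gluing the subgraph induced on [P := {x | x_0 <= x_1}]
    and its image under [phi] along the fixed points of [phi]. *)

Definition induced_adj (G : sgraph) (P : pred G) : rel {x : G | P x} :=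
  fun x y => adj (val x) (val y).

Lemma induced_adj_sym (G : sgraph) (P : pred G) : symmetric (@induced_adj G P).
Proof. by move=> x y; apply: adj_sym. Qed.

Lemma induced_adj_irr (G : sgraph) (P : pred G) :
  irreflexive (@induced_adj G P).
Proof. by move=> x; apply: adj_irr. Qed.

Definition induced (G : sgraph) (P : pred G) : sgraph :=
  SGraph (@induced_adj_sym G P) (@induced_adj_irr G P).

(** Labels have to be natural numbers, so a prescribed set of vertices is labeled by its ranks in
    the enumeration of [A]. *)
Lemma nat_labeling (T : finType) (A : {set T}) :
  exists (L : {fset nat}) (f : L -> T), injective f /\ codom f =i A.
Proof.
pose L : {fset nat} := [fset val i | i in 'I_#|A|]%fset.
have ltL (l : L) : fsval l < #|A|.
  by have /imfsetP[i _ ->] := fsvalP l; apply: ltn_ord.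
exists L, (fun l => enum_val (Ordinal (ltL l))); split.
  by move=> l m /enum_val_inj [lm]; apply: val_inj.
move=> x; apply/codomP/idP => [[l ->]|xA]; first exact: enum_valP.
pose i := enum_rank_in xA x.
have iL : val i \in L by apply: in_imfset.
exists [` iL]%fset; rewrite -{1}(enum_rankK_in xA xA) -/i.
by congr enum_val; apply: val_inj.
Qed.

Section Fold.

Variables (H : plgraph) (G : sgraph) (g : copies H -> G).
Hypothesis g_glue : forall x y, glue x y = (g x == g y).
Hypothesis g_adj : forall x y, copies_adj x y -> adj (g x) (g y).
Hypothesis g_lift : forall a b, adj a b ->
  exists x y, [/\ g x = a, g y = b & copies_adj x y].
Hypothesis g_surj : forall a, exists x, g x == a.

(** The fibres of [g] are exactly the gluing classes and its edges are exactly the images of edges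
    of the copies, so [g] factors through the quotient as an isomorphism. The map built here is its
    inverse, through an arbitrary section [s] of [g]. *)
Lemma square_iso_of_fold : graph_iso G (square H).
Proof.
pose s a := xchoose (g_surj a).
have sK a : g (s a) = a by apply/eqP/(xchooseP (g_surj a)).
have piE x y : (\pi_(square_quot H) x == \pi_(square_quot H) y)%qT
               = (g x == g y) by rewrite -g_glue; apply/eqP/idP => /eqmodP.
have greprK x : g (repr (\pi_(square_quot H) x)%qT) = g x.
  by apply/eqP; rewrite -piE reprK.
exists (fun a => \pi_(square_quot H) (s a))%qT.
  exists (fun q : square_quot H => g (repr q)) => [a|q].
    by rewrite greprK sK.
  by apply/eqP; rewrite -[X in _ == X]reprK piE sK.
move=> a b; apply/idP/idP.
  case/existsP=> x /existsP[y /and3P[]].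
  by rewrite !piE !sK => /eqP <- /eqP <-; apply: g_adj.
case/g_lift=> x [y [gx gy xy]].
apply/existsP; exists x; apply/existsP; exists y.
by rewrite !piE !sK gx gy !eqxx.
Qed.

End Fold.

Section Reflection.

Variables (G : sgraph) (phi : G -> G) (P : pred G).
Hypothesis phiK : involutive phi.
Hypothesis phi_adj : {mono phi : x y / adj x y}.
Hypothesis P_cover : forall x, P x || P (phi x).
Hypothesis P_fix : forall x, P x -> P (phi x) -> phi x = x.
Hypothesis P_cut : forall x y, ~~ P x -> ~~ P (phi y) -> ~~ adj x y.

(** [P] and its image under [phi] cover the vertices by [P_cover], meet only in fixed points by
    [P_fix], and together contain both ends of every edge in a common part by [P_cut]. The labeled
    vertices are the fixed points; a fixed and a moved vertex make them a nonempty proper subset of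
    [P]. *)
Lemma reflection_is_square :
  (exists x, phi x = x) -> (exists x, phi x <> x) -> is_square G.
Proof.
move=> [a aF] [b bF].
have P_of_fix x : phi x = x -> P x by move: (P_cover x) => + e; rewrite e orbb.
have [L [f [f_inj fE]]] :=
  nat_labeling [set v : induced P | phi (val v) == val v].
have ne : exists v : induced P, v \in codom f.
  by exists (Sub a (P_of_fix _ aF)); rewrite fE inE SubK aF.
have pr : exists v : induced P, v \notin codom f.
  case/orP: (P_cover b) => Pb; exists (Sub _ Pb); rewrite fE inE SubK.
    exact/eqP.
  by rewrite phiK eq_sym; apply/eqP.
pose H := PLGraph f_inj ne pr.
(* The second copy is unfolded onto the other side by [phi]. *)
pose g (x : copies H) : G :=
  match x with inl v => val v | inr v => phi (val v) end.
exists H; apply: (@square_iso_of_fold H G g).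
- have labP (u v : induced P) :
    [exists l : L, (u == f l) && (v == f l)]
    = (phi (val u) == val u) && (u == v).
    apply/existsP/andP => [[l /andP[/eqP-> /eqP->]]|[uF /eqP <-]].
      by split=> //; have := codom_f f l; rewrite fE inE.
    have /codomP[l ->] : u \in codom f by rewrite fE inE.
    by exists l; rewrite eqxx.
  (* If vertices of different copies have the same image, then [val v] and [phi (val v)] both
     satisfy [P], so [P_fix] makes them one labeled vertex. *)
  have crossE (u v : induced P) :
    (phi (val u) == val u) && (u == v) = (val u == phi (val v)).
    apply/andP/eqP => [[/eqP uF /eqP <-] //|uv].
    have vF : phi (val v) = val v.
      by apply: P_fix; [exact: valP | rewrite -uv; exact: valP].
    by rewrite -val_eqE /= uv !vF !eqxx.
  move=> x y; rewrite /glue.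
  case: x y => [u|u] [v|v]; rewrite /= labP.
  + rewrite (_ : inl u == inl v :> copies H = (u == v)) // val_eqE.
    by case: (u == v); rewrite ?andbF.
  + exact: crossE.
  + rewrite crossE.
    by rewrite (can2_eq phiK phiK).
  + rewrite (_ : inr u == inr v :> copies H = (u == v)) //.
    by rewrite (inj_eq (inv_inj phiK)) val_eqE; case: (u == v); rewrite ?andbF.
- by move=> [u|u] [v|v] //= uv; rewrite ?phi_adj.
(* An edge inside [P] lifts to the first copy. If one end leaves [P], then [P_cut] forces the whole
   edge into the image of [P], and it lifts to the second copy. *)
- move=> x y xy; have [Px|nPx] := boolP (P x); last first.
    have Pfx : P (phi x) by move: (P_cover x); rewrite (negbTE nPx).
    have Pfy : P (phi y) by apply: contraLR xy; apply: P_cut.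
    exists (inr (Sub _ Pfx)), (inr (Sub _ Pfy)); split=> //=.
    by rewrite /induced_adj !SubK phi_adj.
  have [Py|nPy] := boolP (P y).
    by exists (inl (Sub _ Px)), (inl (Sub _ Py)).
  have Pfy : P (phi y) by move: (P_cover y); rewrite (negbTE nPy).
  have Pfx : P (phi x).
    by apply: contraLR xy => nPfx; rewrite adj_sym; apply: P_cut.
  exists (inr (Sub _ Pfx)), (inr (Sub _ Pfy)); split=> //=.
  by rewrite /induced_adj !SubK phi_adj.
- move=> x; case/orP: (P_cover x) => Px.
    by exists (inl (Sub _ Px)) => /=.
  by exists (inr (Sub _ Px)); rewrite /= phiK.
Qed.

End Reflection.

Definition tuple_perm (n : nat) (s : {perm 'I_n}) (x : n.-tuple bool) :
  n.-tuple bool := [tuple tnth x (s i) | i < n].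

(** The bijection [s] carries the coordinates where the permuted tuples differ onto those where [x]
    and [y] differ. *)
Lemma tuple_perm_adj (n : nat) (s : {perm 'I_n}) :
  {mono @tuple_perm n s : x y / cube_adj x y}.
Proof.
move=> x y; rewrite /cube_adj; congr (_ == 1).
rewrite -(card_imset _ (@perm_inj _ s)); apply: eq_card => i.
rewrite inE; apply/imsetP/idP => [[j + ->]|xyi].
  by rewrite inE !tnth_mktuple.
by exists (s^-1 i)%g; rewrite ?inE ?tnth_mktuple permKV.
Qed.

Lemma cube_adj_diff (n : nat) (x y : n.-tuple bool) (i j : 'I_n) :
  cube_adj x y -> tnth x i != tnth y i -> tnth x j != tnth y j -> i = j.
Proof.
case/cards1P=> k E xi xj.
have : i \in [set k] by rewrite -E inE.
have : j \in [set k] by rewrite -E inE.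
by rewrite !inE => /eqP-> /eqP->.
Qed.

Theorem theorem5p1 (n : nat) (hn : 2 <= n) : is_square (hypercube n).
Proof.
case: n hn => [|[|m]] // _.
pose i0 : 'I_m.+2 := ord0; pose i1 : 'I_m.+2 := lift ord0 ord0.
pose phi := @tuple_perm m.+2 (tperm i0 i1).
pose P (x : m.+2.-tuple bool) := tnth x i0 ==> tnth x i1.
have phi0 x : tnth (phi x) i0 = tnth x i1 by rewrite tnth_mktuple tpermL.
have phi1 x : tnth (phi x) i1 = tnth x i0 by rewrite tnth_mktuple tpermR.
apply: (@reflection_is_square (hypercube m.+2) phi P).
- by move=> x; apply: eq_from_tnth => i; rewrite !tnth_mktuple tpermK.
- exact: tuple_perm_adj.
- by move=> x; rewrite /P phi0 phi1; do 2!case: (tnth x _).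
- move=> x; rewrite /P phi0 phi1 => le01 le10.
  have x01 : tnth x i0 = tnth x i1.
    by apply/idP/idP; [apply: implyP le01 | apply: implyP le10].
  by apply: eq_from_tnth => i; rewrite tnth_mktuple; case: tpermP => // ->.
- move=> x y; rewrite /P phi0 phi1 !negb_imply => /andP[x0 x1] /andP[y1 y0].
  (* Here [x] starts with 10 and [y] with 01, so adjacency would force [i0 = i1]. *)
  apply/negP => /(@cube_adj_diff _ _ _ i0 i1).
  by rewrite x0 y1 (negbTE x1) (negbTE y0) => /(_ isT isT).
- exists [tuple false | i < m.+2].
  by apply: eq_from_tnth => i; rewrite !tnth_mktuple.
(* The vertex 10...0 is moved, since its image is false at [i0]. *)
- exists [tuple i == i0 | i < m.+2] => /(congr1 (fun x => tnth x i0)).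
  by rewrite phi0 !tnth_mktuple.
Qed.
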